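(* Let $G=(V,E)$ be a path, a cycle, or a perfect $n$-ary tree. Then formulation (F2) of the $S$-labeling problem on $G$ has no integrality gap: the optimal value of the LP-relaxation of (F2) equals $\min_\phi SL_\phi(G)$, where the minimum is over all labelings $\phi$ of $G$.
   Context: For a graph $G=(V,E)$ and a labeling (bijection) $\phi:V\to\{1,\ldots,|V|\}$, the $S$-labeling number with respect to $\phi$ is $SL_\phi(G)=\sum_{\{u,v\}\in E}\min\{\phi(u),\phi(v)\}$; the $S$-labeling problem asks for a labeling minimizing it. Formulation (F2), with $V$ identified with $\{1,\ldots,|V|\}$: minimize $\sum_{e\in E}\sum_{k=1}^{|V|}k\,d^k_e$ subject to $\sum_i x^k_i=1$ for all $k\in\{1,\ldots,|V|\}$; $\sum_k x^k_i=1$ for all $i\in V$; $\sum_k d^k_e=1$ for all $e\in E$; $d^k_e\le x^k_i+x^k_{i'}$ for all $k$ and all $e=\{i,i'\}\in E$; $x^k_i\in\{0,1\}$, $d^k_e\in\{0,1\}$. Its LP-relaxation replaces the binary conditions by $0\le x^k_i\le1$, $0\le d^k_e\le1$. A perfect $n$-ary tree ($n\ge1$) is a rooted tree in which all internal (non-leaf) nodes have $n$ children and all leaf nodes are at the same depth. *)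

(* Defs.v *)
From HB Require Import structures.
From mathcomp Require Import all_boot all_order all_algebra.

Set Implicit Arguments.
Unset Strict Implicit.
Unset Printing Implicit Defensive.

Import Order.TTheory GRing.Theory Num.Theory.

Local Open Scope ring_scope.

Record sgraph := SGraph {
  vertex :> finType;
  adj : rel vertex;
  adj_sym : symmetric adj;
  adj_irrefl : irreflexive adj }.

Definition edges (G : sgraph) : {set {set G}} :=
  [set [set p.1; p.2] | p : G * G & adj p.1 p.2].

(* In all that follows, the ordinal k : 'I_#|G| stands for the label k.+1, so
   that 'I_#|G| plays the role of {1, ..., #|G|}. *)

(* The default value #|G| of the iterated minimum is the largest label, hence it
   is neutral: on e = [set u; v] this is min (label of u) (label of v). *)
Definition edge_label (G : sgraph) (phi : G -> 'I_#|G|) (e : {set G}) : nat :=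
  \big[minn/#|G|]_(u in e) (phi u).+1.

Definition SL (G : sgraph) (phi : G -> 'I_#|G|) : nat :=
  (\sum_(e in edges G) edge_label phi e)%N.

(* A pair (x, d) with x k i = x^k_i and d k e = d^k_e; only the values of d k
   at edges matter. *)
Definition F2_vars (R : realFieldType) (G : sgraph) : Type :=
  (('I_#|G| -> G -> R) * ('I_#|G| -> {set G} -> R))%type.

Definition F2_objective (R : realFieldType) (G : sgraph)
    (xd : F2_vars R G) : R :=
  \sum_(e in edges G) \sum_(k < #|G|) (k.+1)%:R * xd.2 k e.

Definition F2_constraints (R : realFieldType) (G : sgraph)
    (xd : F2_vars R G) : Prop :=
  [/\ forall k, \sum_(i : G) xd.1 k i = 1,
      forall i, \sum_(k < #|G|) xd.1 k i = 1,
      forall e, e \in edges G -> \sum_(k < #|G|) xd.2 k e = 1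
    & forall k i i', adj i i' ->
        xd.2 k [set i; i'] <= xd.1 k i + xd.1 k i'].

Definition F2_feasible (R : realFieldType) (G : sgraph)
    (xd : F2_vars R G) : Prop :=
  [/\ F2_constraints xd,
      forall k i, xd.1 k i = 0 \/ xd.1 k i = 1
    & forall k e, e \in edges G -> xd.2 k e = 0 \/ xd.2 k e = 1].

Definition F2_LP_feasible (R : realFieldType) (G : sgraph)
    (xd : F2_vars R G) : Prop :=
  [/\ F2_constraints xd,
      forall k i, 0 <= xd.1 k i <= 1
    & forall k e, e \in edges G -> 0 <= xd.2 k e <= 1].

(* z is the minimum, attained, of f over the points satisfying P. *)
Definition is_min_value (R : realFieldType) (T : Type) (P : T -> Prop)
    (f : T -> R) (z : R) : Prop :=
  (exists2 t, P t & f t = z) /\ (forall t, P t -> z <= f t).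

Definition is_path_graph (G : sgraph) : Prop :=
  (0 < #|G|)%N /\
  exists2 f : G -> 'I_#|G|, bijective f &
    forall u v, adj u v = (f v == (f u).+1 :> nat) || (f u == (f v).+1 :> nat).

Definition is_cycle_graph (G : sgraph) : Prop :=
  (2 < #|G|)%N /\
  exists2 f : G -> 'I_#|G|, bijective f &
    forall u v, adj u v = (f v == (f u).+1 %% #|G| :> nat)%N
                       || (f u == (f v).+1 %% #|G| :> nat)%N.

Definition is_tree (G : sgraph) : Prop :=
  [/\ (0 < #|G|)%N,
      forall u v : G, connect (@adj G) u v
    & forall s : seq G, (2 < size s)%N -> ~ ucycle (@adj G) s].

(* The distance from r to v, i.e. the depth of v when r is the root (and #|G| if
   v is not reachable from r, which does not happen in a tree). *)
Definition depth (G : sgraph) (r v : G) : nat :=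
  find (fun k => [exists p : k.-tuple G, path (@adj G) r p && (last r p == v)])
       (iota 0 #|G|).

Definition children (G : sgraph) (r v : G) : {set G} :=
  [set c | adj v c & depth r c == (depth r v).+1].

(* Leaves are the nodes without children, as usual for rooted trees; in
   particular a root with a single child is internal. *)
Definition is_leaf (G : sgraph) (r v : G) : bool := children r v == set0.

Definition is_perfect_nary_tree (n : nat) (G : sgraph) : Prop :=
  is_tree G /\
  exists r : G,
    (forall v, ~~ is_leaf r v -> #|children r v| = n) /\
    (forall u v, is_leaf r u -> is_leaf r v -> depth r u = depth r v).

(* Main.v *)
(* Put D_k := sum_e d^k_e. Summing the constraints d^k_e <= x^k_i + x^k_i' over
   the edges gives D_k <= Delta, the maximum degree, because sum_i x^k_i = 1;
   moreover sum_k D_k = |E|. Hence the LP value is at least the one obtained by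
   giving the mass Delta to the labels 1, 2, ... greedily until |E| is exhausted.
   A labeling attains this bound if it labels first an independent set S of
   vertices of degree Delta, and then a vertex w such that S together with w
   covers all edges. On a path or a cycle with vertices 0, ..., N - 1, take
   S = {i odd, i < N - 1} and w = N - 1. On a perfect n-ary tree, take for S the
   non-root vertices whose depth has not the parity of the depth of the leaves
   (so Delta = n + 1), and for w the root. *)

Require Import Defs.
From HB Require Import structures.
From mathcomp Require Import all_boot all_order all_algebra.
From mathcomp Require Import zify.

Set Implicit Arguments.
Unset Strict Implicit.
Unset Printing Implicit Defensive.

Import Order.TTheory GRing.Theory Num.Theory.

Local Open Scope ring_scope.

(** * Edges at a vertex and labels of edges *)

Definition nbrs (G : sgraph) (v : G) : {set G} := [set u | adj v u].

Lemma edgesP (G : sgraph) (e : {set G}) :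
  reflect (exists u v, adj u v /\ e = [set u; v]) (e \in edges G).
Proof.
apply: (iffP imsetP) => [[[u v]] /[!inE] /= uv ->|[u [v [uv ->]]]].
  by exists u, v.
by exists (u, v); rewrite ?inE.
Qed.

Lemma adj_neq (G : sgraph) (u v : G) : adj u v -> u != v.
Proof. by apply: contraTneq => ->; rewrite adj_irrefl. Qed.

Lemma set2_injr (T : finType) (v : T) : injective (fun u => [set v; u]).
Proof.
move=> u u' /= eq_uu'; apply/eqP.
have: u \in [set v; u'] by rewrite -eq_uu' set22.
have: u' \in [set v; u] by rewrite eq_uu' set22.
rewrite !inE => /orP[/eqP->|/eqP-> //]; first by rewrite orbb.
Qed.

Lemma card_incident_edges (G : sgraph) (v : G) :
  #|[set e in edges G | v \in e]| = #|nbrs v|.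
Proof.
rewrite -(card_imset _ (@set2_injr _ v)); apply: eq_card => e.
rewrite inE; apply/andP/imsetP => [[/edgesP[a [b [ab ->]]]]|[u]].
  rewrite !inE => /orP[]/eqP ->; first by exists b; rewrite ?inE.
  by exists a; rewrite ?inE 1?adj_sym // setUC.
by rewrite inE => vu ->; split; [apply/edgesP; exists v, u | rewrite set21].
Qed.

Lemma edge_label_set2 (G : sgraph) (phi : G -> 'I_#|G|) (u v : G) : u != v ->
  edge_label phi [set u; v] = (minn (phi u) (phi v)).+1.
Proof.
move=> neq_uv; rewrite /edge_label -minEnat.
rewrite (bigminD1 u) ?set21 // (bigminD1 v) ?set22 1?eq_sym //= big_pred0.
  by rewrite !minEnat (minn_idPl (ltn_ord (phi v))) minnSS.
by move=> i; rewrite !inE; case: (i == u); case: (i == v).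
Qed.

Lemma edge_label_ord (G : sgraph) (phi : G -> 'I_#|G|) (e : {set G}) :
  e \in edges G -> exists k : 'I_#|G|, edge_label phi e = k.+1.
Proof.
case/edgesP=> u [v [uv ->]]; rewrite edge_label_set2 ?adj_neq //.
by case: (leqP (phi u) (phi v)) => _; eexists.
Qed.

(** * Labelings as integral points of (F2) *)

Definition labeling_vars (R : realFieldType) (G : sgraph) (phi : G -> 'I_#|G|) :
    F2_vars R G :=
  (fun k i => (phi i == k)%:R,
   fun (k : 'I__) e => (edge_label phi e == k.+1)%:R).

Lemma sum_eq_op (R : realFieldType) (I : finType) (a : I) (F : I -> R) :
  \sum_i F i * (a == i)%:R = F a.
Proof.
rewrite (bigD1 a) //= eqxx mulr1 big1 ?addr0 // => i.
by rewrite eq_sym => /negPf->; rewrite mulr0.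
Qed.

(** The last constraint holds because the smaller label on an edge is the label of one of its
    endpoints. *)
Lemma labeling_vars_feasible (R : realFieldType) (G : sgraph)
    (phi : G -> 'I_#|G|) : bijective phi -> F2_feasible (labeling_vars R phi).
Proof.
case=> psi phiK psiK; split; first split => /=.
- move=> k; rewrite -[RHS](sum_eq_op (psi k) (fun=> 1)).
  by apply: eq_bigr => i _; rewrite mul1r -(can_eq psiK) phiK eq_sym.
- move=> i; rewrite -[RHS](sum_eq_op (phi i) (fun=> 1)).
  by apply: eq_bigr => k _; rewrite mul1r.
- move=> e /(edge_label_ord phi)[k ->].
  rewrite -[RHS](sum_eq_op k (fun=> 1)).
  by apply: eq_bigr => j _; rewrite mul1r eqSS.
- move=> k i j /adj_neq neq_ij; rewrite edge_label_set2 // eqSS -!val_eqE /=.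
  rewrite -natrD ler_nat.
  by case: (leqP (phi i) (phi j)) => _; case: (_ == _); case: (_ == _).
- by move=> k i /=; case: eqP; [right|left].
- by move=> k e _ /=; case: eqP; [right|left].
Qed.

Lemma labeling_vars_objective (R : realFieldType) (G : sgraph)
    (phi : G -> 'I_#|G|) : F2_objective (labeling_vars R phi) = (SL phi)%:R.
Proof.
rewrite /F2_objective /SL natr_sum; apply: eq_bigr => e.
case/(edge_label_ord phi)=> k ek; rewrite ek /=.
rewrite -(sum_eq_op k (fun k : 'I__ => k.+1%:R)).
by apply: eq_bigr => j _; rewrite ek eqSS.
Qed.

Lemma F2_feasible_LP (R : realFieldType) (G : sgraph) (xd : F2_vars R G) :
  F2_feasible xd -> F2_LP_feasible xd.
Proof.
case=> cxd x01 d01; split=> // [k i|k e eE].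
  by case: (x01 k i) => ->; rewrite ?lexx ?ler01.
by case: (d01 k e eE) => ->; rewrite ?lexx ?ler01.
Qed.

(** * The LP bound, label by label *)

Lemma F2_objectiveE (R : realFieldType) (G : sgraph) (xd : F2_vars R G) :
  F2_objective xd =
  \sum_(k < #|G|) (k.+1)%:R * \sum_(e in edges G) xd.2 k e.
Proof.
rewrite /F2_objective exchange_big; apply: eq_bigr => k _.
by rewrite big_distrr.
Qed.

Lemma F2_sum_d (R : realFieldType) (G : sgraph) (xd : F2_vars R G) :
  F2_constraints xd ->
  \sum_(k < #|G|) \sum_(e in edges G) xd.2 k e = #|edges G|%:R.
Proof.
case=> _ _ sum_d _; rewrite exchange_big (eq_bigr (fun=> 1)) //=.
by rewrite sumr_const.
Qed.

Lemma F2_LP_level_le (R : realFieldType) (G : sgraph) (Dl : nat)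
    (xd : F2_vars R G) (k : 'I_#|G|) :
  (forall v : G, #|nbrs v| <= Dl)%N -> F2_LP_feasible xd ->
  \sum_(e in edges G) xd.2 k e <= Dl%:R.
Proof.
move=> deg_le [[sum_x _ _ d_le] x01 _].
have x_ge0 i : 0 <= xd.1 k i by case/andP: (x01 k i).
apply: (@le_trans _ _ (\sum_(e in edges G) \sum_(i in e) xd.1 k i)).
  apply: ler_sum => e /edgesP[u [v [uv ->]]].
  by rewrite big_setU1 ?big_set1 ?inE ?adj_neq ?d_le.
(* Double counting: [xd.1 k i] now occurs once for each edge at [i], that is [#|nbrs i|] times. *)
rewrite (exchange_big_dep predT) //=.
apply: (@le_trans _ _ (\sum_i Dl%:R * xd.1 k i)).
  apply: ler_sum => i _; rewrite sumr_const -[leLHS]mulr_natl.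
  rewrite ler_wpM2r // ler_nat (leq_trans _ (deg_le i)) //.
  by rewrite -card_incident_edges;
    apply: eq_leq; apply: eq_card => e; rewrite inE.
by rewrite -mulr_sumr sum_x mulr1.
Qed.

(* Exchange argument: with equal total mass, weighting by [k - m] instead of
   [k + 1] does not change the difference of the two sums. *)
Lemma greedy_sum_le (R : realFieldType) (N m : nat) (Dl : R) (g h : 'I_N -> R) :
  \sum_k g k = \sum_k h k ->
  (forall k, h k <= Dl) -> (forall k, 0 <= h k) ->
  (forall k : 'I_N, (k < m)%N -> Dl <= g k) ->
  (forall k : 'I_N, (m < k)%N -> g k = 0) ->
  \sum_(k < N) (k.+1)%:R * g k <= \sum_(k < N) (k.+1)%:R * h k.
Proof.
move=> eq_gh h_le h_ge0 g_lo g_hi.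
suff: 0 <= \sum_(k < N) (k.+1%:R - m.+1%:R) * (h k - g k).
  rewrite (eq_bigr (fun k : 'I_N => k.+1%:R * h k - k.+1%:R * g k
     - m.+1%:R * (h k - g k))); last first.
    by move=> k _; rewrite mulrBl mulrBr.
  by rewrite !sumrB -mulr_sumr sumrB eq_gh subrr mulr0 subr0 subr_ge0.
(* Below [m] both factors are nonpositive, above [m] both are nonnegative. At [m] the weight
   vanishes, so [g] may carry there whatever mass remains. *)
apply: sumr_ge0 => k _; case: (ltngtP k m) => [lt_km|lt_mk|->].
- rewrite mulr_le0 ?subr_le0 ?ler_nat ?ltnS 1?ltnW //.
  exact: le_trans (h_le k) (g_lo k lt_km).
- by rewrite mulr_ge0 ?subr_ge0 ?ler_nat ?ltnS 1?ltnW // g_hi.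
- by rewrite subrr mul0r.
Qed.

(** * Labelings that meet the LP bound *)

Lemma exists_labeling (G : sgraph) (S : {set G}) (w : G) : w \notin S ->
  exists2 phi : G -> 'I_#|G|, bijective phi &
    (forall v, (phi v < #|S|)%N = (v \in S)) /\ phi w = #|S| :> nat.
Proof.
(* The label of a vertex is its position in the list: first [S], then [w], then the rest. *)
move=> wS; pose s := enum S ++ w :: enum (~: (w |: S)).
have s_uniq : uniq s.
  rewrite cat_uniq /= !enum_uniq mem_enum (negPf wS) mem_enum.
  rewrite !inE eqxx /= andbT.
  by apply/hasPn => v; rewrite !mem_enum !inE negb_or => /andP[].
have s_mem v : v \in s.
  by rewrite mem_cat inE !mem_enum !inE; case: (v \in S); case: (v == w).
have size_s : size s = #|G|.
  by rewrite -(card_uniqP s_uniq); apply: eq_card => v; rewrite s_mem.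
have idx_lt v : (index v s < #|G|)%N by rewrite -size_s index_mem.
exists (fun v => Ordinal (idx_lt v)).
  apply: inj_card_bij; last by rewrite card_ord.
  by move=> u v [] /(congr1 (nth w s)); rewrite !nth_index.
split=> [v|] /=; rewrite /s index_cat mem_enum; last first.
  by rewrite (negPf wS) /= eqxx addn0 -cardE.
case: ifP => vS; first by rewrite cardE index_mem mem_enum.
by apply/negbTE; rewrite -leqNgt cardE leq_addr.
Qed.

(** Labelings embed into the points of (F2), and these into the points of the relaxation; hence such
    a [phi] is optimal for all three problems at once. *)
Definition has_LP_tight_labeling (R : realFieldType) (G : sgraph) : Prop :=
  exists2 phi : G -> 'I_#|G|, bijective phi &
    forall xd : F2_vars R G, F2_LP_feasible xd ->
      (SL phi)%:R <= F2_objective xd.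

(* As S is independent and labeled first, the edges whose smaller label is that
   of a given v in S are exactly the Dl edges at v; as w is labeled next, no
   edge has its smaller label beyond #|S| + 1. *)
Lemma greedy_labeling (R : realFieldType) (G : sgraph) (Dl : nat) (S : {set G})
    (w : G) :
  (forall v : G, #|nbrs v| <= Dl)%N ->
  {in S, forall v, #|nbrs v| = Dl} ->
  w \notin S ->
  {in S &, forall u v, ~~ adj u v} ->
  (forall u v, adj u v -> [|| u \in w |: S | v \in w |: S]) ->
  has_LP_tight_labeling R G.
Proof.
move=> deg_le deg_S wS S_indep S_cover.
have [phi phi_bij [phi_S phi_w]] := exists_labeling wS.
exists phi => // xd xdF; rewrite -labeling_vars_objective !F2_objectiveE.
have [pcons _ _] := labeling_vars_feasible R phi_bij.
have [xcons _ d01] := xdF.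
(* Here [g] and [h] are the masses per label of the labeling and of [xd]; the threshold [#|S|] is
   the ordinal given to [w]. *)
apply: (@greedy_sum_le _ _ #|S| Dl%:R).
- by rewrite !F2_sum_d.
- by move=> k; apply: F2_LP_level_le.
- by move=> k; apply: sumr_ge0 => e eE; case/andP: (d01 k e eE).
- move=> k lt_kS; case: phi_bij => psi phiK psiK.
  have pkS : psi k \in S by rewrite -phi_S psiK.
  rewrite /= -natr_sum ler_nat -(deg_S _ pkS) -card_incident_edges.
  rewrite -sum1_card big_mkcond [leqRHS]big_mkcond /=.
  apply: leq_sum => e _; rewrite inE; case: ifP => // /andP[eE].
  rewrite eE; case/edgesP: eE => u [v [uv ->]].
  (* Edges are unordered, so the endpoint labeled [k] may be called [u]; independence then puts [v]
     outside [S], hence later in the labeling. *)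
  wlog pk : u v uv / psi k = u => [IH|].
    rewrite !inE => /orP[]/eqP E; first by apply: IH => //; rewrite ?E ?set21.
    by rewrite setUC; apply: IH => //; rewrite ?E ?set21 // adj_sym.
  have u_S := pkS; rewrite pk in u_S.
  have vS : v \notin S by apply: contraL uv => vS; apply: S_indep.
  have k_u : k = phi u by rewrite -pk psiK.
  rewrite edge_label_set2 ?adj_neq // k_u (minn_idPl _) ?eqxx //.
  by rewrite ltnW // (leq_trans (_ : _ < #|S|)%N) ?phi_S // leqNgt phi_S.
- move=> k lt_Sk; apply: big1 => e /edgesP[u [v [uv ->]]] /=.
  have cov_le x : x \in w |: S -> (phi x <= #|S|)%N.
    by rewrite !inE => /orP[/eqP->|]; rewrite ?phi_w // -phi_S => /ltnW.
  rewrite edge_label_set2 ?adj_neq // eqSS ltn_eqF // gtn_min.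
  by case/orP: (S_cover _ _ uv) => /cov_le H; rewrite (leq_ltn_trans H) ?orbT.
Qed.

(** * Paths and cycles *)

Lemma succ_modn (N a : nat) : (a < N)%N ->
  (a.+1 %% N = if a.+1 == N then 0 else a.+1)%N.
Proof.
move=> lt_aN; case: eqVneq => [->|neq]; first by rewrite modnn.
by rewrite modn_small // ltn_neqAle neq.
Qed.

Lemma succ_modn_inj (N a b : nat) : (a < N)%N -> (b < N)%N ->
  (a.+1 %% N = b.+1 %% N)%N -> a = b.
Proof.
move=> lt_a lt_b; rewrite !succ_modn //.
case: (eqVneq a.+1 N) => [aN|_]; case: (eqVneq b.+1 N) => [bN|_] //.
  by move=> _; apply: succn_inj; rewrite aN.
by case.
Qed.

(** Paths and cycles are treated together: consecutive positions are adjacent, and the closing edge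
    between the last position and position 0 may or may not be present. *)
Lemma cyclic_order_labeling (R : realFieldType) (G : sgraph)
    (f : G -> 'I_#|G|) :
  (0 < #|G|)%N -> bijective f ->
  (forall u v, f v = (f u).+1 :> nat -> adj u v) ->
  (forall u v, adj u v ->
     f v = (f u).+1 %% #|G| :> nat \/ f u = (f v).+1 %% #|G| :> nat)%N ->
  has_LP_tight_labeling R G.
Proof.
move=> n_gt0 [g fK gK] adj_succ succ_adj.
have f_inj := can_inj fK.
have fg_nat k (lt_kn : (k < #|G|)%N) : f (g (Ordinal lt_kn)) = k :> nat.
  by rewrite gK.
have deg_le (v : G) : (#|nbrs v| <= 2)%N.
  (* Neighbours are cyclic successors or cyclic predecessors, with at most one of each. *)
  have -> : nbrs v = [set u in nbrs v | f u == (f v).+1 %% #|G| :> nat]%N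
                 :|: [set u in nbrs v | f v == (f u).+1 %% #|G| :> nat]%N.
    apply/setP => u; rewrite !inE -andb_orr; case vu: (adj v u) => //=.
    by apply/esym/orP; case: (succ_adj _ _ vu) => ->; [left|right].
  apply: leq_trans (leq_card_setU _ _) _; apply: (@leq_add _ _ 1 1);
    apply/card_le1_eqP => a b;
    rewrite !inE => /andP[_ /eqP fa] /andP[_ /eqP fb];
    apply: f_inj; apply: ord_inj; first by rewrite /= fa fb.
  by apply: succ_modn_inj (ltn_ord _) (ltn_ord _) _; rewrite -fa.
have last_lt : (#|G|.-1 < #|G|)%N by rewrite prednK.
(* Oddness excludes position 0 and the second condition the last position, so each vertex of [S] has
   both a predecessor and a successor. The last vertex, as [w], covers the closing edge and, for
   even [#|G|], the edge before it. *)
apply: (@greedy_labeling R G 2 [set v | odd (f v) & ((f v).+1 < #|G|)%N]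
  (g (Ordinal last_lt))) => //.
- move=> v; rewrite inE => /andP[odd_v lt_v]; apply/eqP; rewrite eqn_leq deg_le.
  have lt_p : ((f v).-1 < #|G|)%N by apply: leq_ltn_trans (leq_pred _) _.
  apply/card_gt1P; exists (g (Ordinal lt_p)), (g (Ordinal lt_v)).
  rewrite !inE (can_eq gK) -val_eqE /=; split; last by lia.
    by rewrite adj_sym; apply: adj_succ; rewrite fg_nat prednK ?odd_gt0.
  by apply: adj_succ; rewrite fg_nat.
- by rewrite inE fg_nat prednK // ltnn andbF.
- move=> u v; rewrite !inE => /andP[odd_u lt_u] /andP[odd_v lt_v].
  (* Away from the last position no successor wraps around, so adjacent vertices have opposite
     parities. *)
  by apply/negP => /succ_adj; rewrite !succ_modn ?ltn_ord // !ltn_eqF //; lia.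
- have last_eq x : (f x).+1 = #|G| -> x = g (Ordinal last_lt).
    move=> fx; apply: f_inj; apply: ord_inj; apply: succn_inj.
    by rewrite fg_nat prednK.
  move=> u v uv; rewrite !inE.
  case: (eqVneq (f u).+1 #|G|) => [/last_eq->|neq_u]; first by rewrite eqxx.
  case: (eqVneq (f v).+1 #|G|) => [/last_eq->|neq_v].
    by rewrite eqxx orbT.
  have lt_u : ((f u).+1 < #|G|)%N by rewrite ltn_neqAle neq_u ltn_ord.
  have lt_v : ((f v).+1 < #|G|)%N by rewrite ltn_neqAle neq_v ltn_ord.
  rewrite lt_u lt_v !andbT; move: (succ_adj _ _ uv); rewrite !modn_small //.
  by case=> ->; rewrite oddS; case: (odd _); rewrite ?orbT.
Qed.

(** * Depth, parents and degrees in a rooted tree *)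

Section Depth.

Variables (G : sgraph) (r : G).
Hypothesis G_conn : forall u v : G, connect (@adj G) u v.

Lemma depth_path (v : G) :
  exists p, [/\ path (@adj G) r p, last r p = v & size p = depth r v].
Proof.
pose P k := [exists p : k.-tuple G, path (@adj G) r p && (last r p == v)].
have hasP : has P (iota 0 #|G|).
  (* A path without repetitions has fewer than [#|G|] edges, so the search in [depth] succeeds
     before reaching its default. *)
  have /connectP[p] := G_conn r v; case/shortenP=> p' p'_path p'_uniq _ def_v.
  apply/hasP; exists (size p').
    rewrite mem_iota /= add0n -ltnS.
    by have := max_card (mem (r :: p')); rewrite (card_uniqP p'_uniq).
  by apply/existsP; exists (in_tuple p'); rewrite p'_path def_v eqxx.
have := nth_find 0%N hasP.
rewrite -/(depth r v) nth_iota -?has_find; last first.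
  by move: hasP; rewrite has_find size_iota.
case/existsP=> p /andP[p_path /eqP p_last]; exists p; split=> //.
by rewrite size_tuple.
Qed.

Lemma depth_le (p : seq G) :
  path (@adj G) r p -> (depth r (last r p) <= size p)%N.
Proof.
move=> p_path; rewrite leqNgt; apply/negP => lt_p.
have lt_pG : (size p < #|G|)%N.
  by apply: leq_trans lt_p _; rewrite -[leqRHS](size_iota 0) find_size.
have /negP := negbT (before_find 0%N lt_p); rewrite nth_iota //; apply.
by apply/existsP; exists (in_tuple p); rewrite p_path eqxx.
Qed.

Lemma depth_root : depth r r = 0%N.
Proof. by apply/eqP; rewrite -leqn0 (@depth_le [::]). Qed.

Lemma depth_adj_le (u v : G) : adj u v -> (depth r v <= (depth r u).+1)%N.
Proof.
have [p [p_path p_last <-]] := depth_path u => uv.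
have := @depth_le (rcons p v); rewrite last_rcons size_rcons; apply.
by rewrite rcons_path p_path p_last.
Qed.

(** The parent is the last but one vertex of a shortest path from the root. *)
Lemma depth_parent (v : G) :
  v != r -> exists2 u, adj v u & depth r v = (depth r u).+1.
Proof.
have [p [+ + eq_d]] := depth_path v.
case/lastP: p eq_d => [|p w] eq_d; first by move=> _ /= ->; rewrite eqxx.
rewrite rcons_path last_rcons => /andP[p_path + w_v] _.
rewrite {}w_v => uv; exists (last r p); first by rewrite adj_sym.
apply/eqP; rewrite eqn_leq depth_adj_le //= -eq_d size_rcons ltnS.
exact: depth_le.
Qed.

Hypothesis G_acyclic :
  forall s : seq G, (2 < size s)%N -> ~ ucycle (@adj G) s.

(** A simple path from [u] to [v] avoiding the edge would be closed by it to a cycle. *)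
Lemma tree_bridge (u v : G) : adj u v ->
  ~ connect [rel a b | adj a b && ([set a; b] != [set u; v])] u v.
Proof.
move=> uv /connectP[p] /shortenP[p' p'_path p'_uniq _] def_v.
apply: (@G_acyclic (u :: p')); last first.
  rewrite /ucycle p'_uniq andbT /= rcons_path -def_v adj_sym uv andbT.
  by apply: sub_path p'_path => a b /andP[].
(* The cycle has at least three vertices: length 0 would make [uv] a loop, and length 1 would use
   the removed edge. *)
case: p' p'_path def_v {p'_uniq} => [|a [|b p']] //=.
  by move=> _ def_v; rewrite def_v adj_irrefl in uv.
by move=> /[swap] <-; rewrite eqxx andbF.
Qed.

(* If every vertex other than the root could descend without the edge uv, then
   u and v would be joined through the root, and uv would not be a bridge. *)
Lemma tree_descent_needs_edge (u v : G) : adj u v ->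
  (forall w, w != r -> exists t,
     [/\ adj w t, [set w; t] != [set u; v] & (depth r t < depth r w)%N]) ->
  False.
Proof.
move=> uv descent; apply: (tree_bridge uv).
set e := [rel a b | _].
have e_sym : connect_sym e.
  by apply: sym_connect_sym => a b; rewrite /= adj_sym setUC.
have to_root w : connect e w r.
  have [m] := ubnP (depth r w); elim: m w => // m IH w lt_w.
  have [->//|/descent[t [wt neq_e lt_t]]] := eqVneq w r.
  apply: connect_trans (connect1 _) (IH t _); first by rewrite /= wt.
  exact: leq_trans lt_t _.
by apply: connect_trans (to_root u) _; rewrite e_sym.
Qed.

(** Depths of neighbours differ by at most 1. If they were equal, no step to a parent would use
    [uv], and every vertex could descend without it. *)
Lemma tree_adj_depth (u v : G) : adj u v ->
  depth r v = (depth r u).+1 \/ depth r u = (depth r v).+1.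
Proof.
move=> uv; have le_v := depth_adj_le uv.
have := uv; rewrite adj_sym => /depth_adj_le le_u.
have [eq_d|] := eqVneq (depth r u) (depth r v); last by lia.
case: (tree_descent_needs_edge uv) => w /depth_parent[t wt eq_w].
exists t; split=> //; last by rewrite eq_w.
apply: contra_eq_neq eq_w => e_eq; apply/eqP.
have : w \in [set u; v] by rewrite -e_eq set21.
have : t \in [set u; v] by rewrite -e_eq set22.
by rewrite !inE => /orP[]/eqP-> /orP[]/eqP->; lia.
Qed.

(** With a second parent [u2], the vertex [v] descends without the edge to [u1], and so does every
    other vertex through any of its parents. *)
Lemma tree_parent_uniq (v u1 u2 : G) : adj v u1 -> adj v u2 ->
  depth r v = (depth r u1).+1 -> depth r v = (depth r u2).+1 -> u1 = u2.
Proof.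
move=> vu1 vu2 d1 d2; apply/eqP/negPn/negP => neq_u.
apply: (tree_descent_needs_edge vu1) => w w_r.
have [->|neq_wv] := eqVneq w v.
  by exists u2; rewrite (inj_eq (@set2_injr _ v)) eq_sym neq_u d2.
have [t wt eq_w] := depth_parent w_r.
exists t; split=> //; last by rewrite eq_w.
(* As [w] is not [v], it would be [u1] with parent [v], against the depth of [u1]. *)
apply/eqP => e_eq.
have : w \in [set v; u1] by rewrite -e_eq set21.
have : t \in [set v; u1] by rewrite -e_eq set22.
rewrite !inE (negPf neq_wv) /= => /orP[]/eqP Et /eqP Ew; move: eq_w d1;
  rewrite Et Ew; lia.
Qed.

Lemma card_nbrs_root : #|nbrs r| = #|children r r|.
Proof.
apply: eq_card => u; rewrite !inE depth_root; case ru: (adj r u) => //=.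
by case: (tree_adj_depth ru); rewrite depth_root // => ->.
Qed.

Lemma card_nbrs_nonroot (v : G) : v != r -> #|nbrs v| = #|children r v|.+1.
Proof.
move=> /depth_parent[t vt eq_v].
have -> : nbrs v = t |: children r v.
  apply/setP => u; rewrite !inE; have [->|neq_u] := eqVneq u t; first exact: vt.
  case vu: (adj v u) => //=; case: (tree_adj_depth vu) => [->|d_v].
    by rewrite eqxx.
  by rewrite (tree_parent_uniq vu vt d_v eq_v) eqxx in neq_u.
by rewrite cardsU1 !inE eq_v; case: eqP; rewrite ?andbF //; lia.
Qed.

End Depth.

(** * Perfect n-ary trees *)

Lemma perfect_nary_tree_labeling (R : realFieldType) (n : nat) (G : sgraph) :
  is_perfect_nary_tree n G ->
  has_LP_tight_labeling R G.
Proof.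
case=> [[_ G_conn G_acyc]] [r [n_children leaf_depth]].
(* A deepest vertex is a leaf, so its depth is the common depth of the leaves. *)
have [l _ l_max] := arg_maxnP (depth r) (isT : xpredT r).
have l_leaf : is_leaf r l.
  apply/eqP/setP => c; rewrite !inE; apply/negbTE/negP => /andP[_ /eqP eq_c].
  have: (depth r c <= depth r l)%N := l_max c isT.
  by rewrite eq_c ltnn.
apply: (@greedy_labeling R G n.+1
  [set v | v != r & odd (depth r v) != odd (depth r l)] r).
- move=> v; have children_le : (#|children r v| <= n)%N.
    have [/eqP->|/n_children-> //] := boolP (is_leaf r v).
    by rewrite cards0.
  move: children_le; have [->|/card_nbrs_nonroot -> //] := eqVneq v r.
  by rewrite card_nbrs_root //; apply: leqW.
- move=> v; rewrite inE => /andP[v_r odd_v].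
  rewrite (@card_nbrs_nonroot _ r) // n_children //.
  by apply: contra odd_v => v_leaf; rewrite (leaf_depth v l).
- by rewrite !inE eqxx.
- move=> u v; rewrite !inE => /andP[_ odd_u] /andP[_ odd_v].
  apply/negP => /(tree_adj_depth r G_conn G_acyc) [] d; move: odd_u odd_v;
    by rewrite d oddS; case: (odd _); case: (odd _).
- move=> u v /(tree_adj_depth r G_conn G_acyc); rewrite !inE.
  case: (u == r) => //; case: (v == r) => //=; rewrite ?orbT //.
  by case=> ->; rewrite oddS; case: (odd _); case: (odd _).
Qed.

Theorem mainTheorem6 (R : realFieldType) (G : sgraph) :
  is_path_graph G \/ is_cycle_graph G \/
    (exists2 n : nat, (0 < n)%N & is_perfect_nary_tree n G) ->
  exists z : R,
    [/\ is_min_value (fun phi : G -> 'I_#|G| => bijective phi)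
                     (fun phi => (SL phi)%:R) z,
        is_min_value (@F2_feasible R G) (@F2_objective R G) z
      & is_min_value (@F2_LP_feasible R G) (@F2_objective R G) z].
Proof.
move=> G_class.
have [phi phi_bij phi_opt] : has_LP_tight_labeling R G.
  case: G_class => [|[]].
  - case=> G_gt0 [f f_bij adjE]; apply: (cyclic_order_labeling R G_gt0 f_bij).
      by move=> u v fv; rewrite adjE fv eqxx.
    (* On a path the successor is itself a position below [#|G|], so reduction modulo [#|G|] leaves
       it unchanged. *)
    by move=> u v; rewrite adjE => /orP[]/eqP E; [left|right];
      rewrite -E modn_small ?ltn_ord.
  - case=> G_gt2 [f f_bij adjE].
    apply: (@cyclic_order_labeling R G f) => //; first exact: ltnW (ltnW _).
      move=> u v fv; rewrite adjE -fv modn_small ?ltn_ord //.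
      by rewrite eqxx.
    by move=> u v; rewrite adjE => /orP[]/eqP; [left|right].
  - by case=> n _; apply: perfect_nary_tree_labeling.
have phi_feas := labeling_vars_feasible R phi_bij.
have phi_obj := labeling_vars_objective R phi.
exists (SL phi)%:R; split; split.
- by exists phi.
- move=> psi /(labeling_vars_feasible R)/F2_feasible_LP/phi_opt.
  by rewrite labeling_vars_objective.
- by exists (labeling_vars R phi).
- by move=> xd /F2_feasible_LP/phi_opt.
- by exists (labeling_vars R phi) => //; apply: F2_feasible_LP.
- exact: phi_opt.
Qed.
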